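(* Let $M$ be a smooth manifold (finite- or infinite-dimensional), $A^1,\dots,A^d$ $(1,1)$-tensor fields on $M$, $Q$ a tangent vector field on $M$, and consider the equation $\frac{\partial u}{\partial t}+\sum_{j=1}^d A^j\frac{\partial u}{\partial x^j}=Q|_u$ for $u=u(t,\boldsymbol x)\in M$. Let $i:\hat M\to M$ be an embedded submanifold and $p:M\to\hat M$ a smooth map with $p\circ i=\mathrm{id}_{\hat M}$, and consider the reduced model on $\hat M$ $$\frac{\partial\hat u}{\partial t}+\sum_{j=1}^d\hat A^j\frac{\partial\hat u}{\partial x^j}=\hat Q|_{\hat u},\qquad \hat A^j:=p_*\circ A^j\circ i_*,\quad \hat Q:=p_*\circ Q\circ i .$$ Suppose that $\boldsymbol F_c=(F_c^1,\dots,F_c^d):M\to\mathbb R^d$ is the flux of $c:M\to\mathbb R$ for the original equation. Let $\hat c:=c\circ i$ and $\hat{\boldsymbol F}_{\hat c}:=\boldsymbol F_c\circ i$. If $$p^*\,\mathrm d\hat c|_{\hat u}=\mathrm dc|_{i(\hat u)}\qquad\text{for each }\hat u\in\hat M,$$ then $\hat{\boldsymbol F}_{\hat c}$ is the flux of $\hat c$ for the reduced model. Furthermore, for every solution $\hat u$ of the reduced model, $$\frac{\partial\hat c}{\partial t}+\nabla_{\boldsymbol x}\cdot\hat{\boldsymbol F}_{\hat c}=\langle\mathrm dc,Q\rangle|_{i(\hat u)},$$ where on the left $\hat c$ and $\hat{\boldsymbol F}_{\hat c}$ stand for $\hat c\circ\hat u$ and $\hat{\boldsymbol F}_{\hat c}\circ\hat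 u$.
   Context: A $(1,1)$-tensor field is regarded as a fibrewise linear map $TM\to TM$. $i_*,p_*$ are the differentials of $i,p$; $p_*$ is applied at points $i(\hat u)$, and $p^*:T^*_{\hat u}\hat M\to T^*_{i(\hat u)}M$ is the dual (pullback) map, i.e. $\langle p^*\alpha,X\rangle=\langle\alpha,p_*X\rangle$. Flux: for smooth functions $c:M\to\mathbb R$ and $\boldsymbol F_c=(F_c^1,\dots,F_c^d):M\to\mathbb R^d$, $\boldsymbol F_c$ is called the flux of $c$ for the equation $\partial_tu+\sum_jA^j\partial_{x^j}u=Q|_u$ if $\langle\mathrm dF_c^j,X\rangle=\langle\mathrm dc,A^jX\rangle$ for each $X\in\Gamma(TM)$ and each $j=1,\dots,d$. The same definition, with $\hat M,\hat A^j$ in place of $M,A^j$, applies to the reduced model. *)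

(* Defs.v *)
From HB Require Import structures.
From mathcomp Require Import all_boot all_order all_algebra.
From mathcomp Require Import all_classical all_reals all_analysis.

Set Implicit Arguments.
Unset Strict Implicit.
Unset Printing Implicit Defensive.

Import Order.TTheory GRing.Theory Num.Theory.
Import numFieldNormedType.Exports.

Local Open Scope classical_set_scope.
Local Open Scope ring_scope.

(** * Differential calculus on locally convex spaces

    The library defines [derivable] and ['D_v f] on normed modules only; the
    following are their analogues on locally convex spaces.  [gderive] is only
    meaningful when [F] is Hausdorff and [f] is derivable at [x] along [v]; it
    is [0] by convention when there is no derivative. *)

Definition is_gderive (R : realType) (E F : tvsType R) (f : E -> F) (x v : E)
    (l : F) :=
  (fun h : R => h^-1 *: (f (h *: v + x) - f x)) @ 0^' --> l.

Definition gderivable (R : realType) (E F : tvsType R) (f : E -> F) (x v : E) :=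
  exists l, is_gderive f x v l.

Definition gderive (R : realType) (E F : tvsType R) (f : E -> F) (x v : E) : F :=
  xget 0 [set l | is_gderive f x v l].

(** Class C^n on an open set [U] in the sense of Michal and Bastiani, the
    usual calculus for manifolds modelled on locally convex spaces: [f] is
    C^(n+1) when it is continuous, all its directional derivatives exist, and
    [(x, v) |-> gderive f x v] is C^n on [U * E].  Between Banach spaces, being C^n
    for all [n] in this sense is the same as being C^oo in the Frechet sense. *)
Fixpoint Cn (R : realType) (n : nat) (E F : tvsType R) (U : set E)
    (f : E -> F) {struct n} : Prop :=
  (forall x, U x -> {for x, continuous f}) /\
  match n with
  | 0 => True
  | m.+1 => (forall x v, U x -> gderivable f x v) /\
            Cn m (U `*` [set: E]) (fun xv : E * E => gderive f xv.1 xv.2)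
  end.

Definition smooth_on (R : realType) (E F : tvsType R) (U : set E) (f : E -> F) :=
  forall n, Cn n U f.

(** * Smooth manifolds

    The model space is an arbitrary Hausdorff locally convex space: ['rV[R]_n]
    gives the manifolds of dimension [n], Banach and Frechet spaces give the
    Banach and Frechet manifolds.  [chart a] and [chart_inv a] are total
    functions which are meaningful on [chart_dom a] and [chart_cod a] only.
    [chart_at u] selects a chart around [u]; see [tangent]. *)
Record manifold (R : realType) := Manifold {
  model : tvsType R ;
  points :> topologicalType ;
  model_hausdorff : hausdorff_space model ;
  points_hausdorff : hausdorff_space points ;
  chart_index : Type ;
  chart_dom : chart_index -> set points ;
  chart_cod : chart_index -> set model ;
  chart : chart_index -> points -> model ;
  chart_inv : chart_index -> model -> points ;
  chart_dom_open : forall a, open (chart_dom a) ;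
  chart_cod_open : forall a, open (chart_cod a) ;
  chart_domP : forall a u, chart_dom a u -> chart_cod a (chart a u) ;
  chart_codP : forall a x, chart_cod a x -> chart_dom a (chart_inv a x) ;
  chartK : forall a u, chart_dom a u -> chart_inv a (chart a u) = u ;
  chart_invK : forall a x, chart_cod a x -> chart a (chart_inv a x) = x ;
  chart_continuous : forall a u, chart_dom a u -> {for u, continuous (chart a)} ;
  chart_inv_continuous :
    forall a x, chart_cod a x -> {for x, continuous (chart_inv a)} ;
  chart_transition : forall a b,
    smooth_on (chart_cod a `&` chart_inv a @^-1` chart_dom b)
              (chart b \o chart_inv a) ;
  chart_at : points -> chart_index ;
  chart_atP : forall u, chart_dom (chart_at u) u
}.

Arguments chart_dom {R m}.
Arguments chart_cod {R m}.
Arguments chart {R m}.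
Arguments chart_inv {R m}.
Arguments chart_at {R m}.

(** [T_u M] is the space of coordinate vectors in the selected chart
    [chart_at u]; coordinates in another chart are obtained by differentiating
    the transition map ([to_chart], [of_chart]).  As the carrier does not depend
    on [u], a proof of [u = u'] never has to be transported: a vector of
    [tangent u'] is accepted where one of [tangent u] is expected.  This is
    used below only when [u = u'] holds. *)
Definition tangent (R : realType) (M : manifold R) (u : M) : tvsType R := model M.

Section TangentVectors.
Context {R : realType} {M : manifold R}.

Definition to_chart (a : chart_index M) (u : M) (X : tangent u) : model M :=
  gderive (chart a \o chart_inv (chart_at u)) (chart (chart_at u) u) X.

Definition of_chart (a : chart_index M) (u : M) (v : model M) : tangent u :=
  gderive (chart (chart_at u) \o chart_inv a) (chart a u) v.

Arguments to_chart a u X : clear implicits.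
Arguments of_chart a u v : clear implicits.

Definition smooth_function (W : tvsType R) (f : M -> W) :=
  forall a, smooth_on (chart_cod a) (f \o chart_inv a).

(** [dfun f u X] is [<df, X>] at [u]. *)
Definition dfun (f : M -> R) (u : M) (X : tangent u) : R :=
  gderive (f \o chart_inv (chart_at u)) (chart (chart_at u) u) X.

Arguments dfun f u X : clear implicits.

(** Smooth sections of [TM] over the open set [U]; the values of [X] outside
    [U] are irrelevant. *)
Definition vector_field_on (U : set M) (X : forall u : M, tangent u) :=
  forall a, smooth_on (chart_cod a `&` chart_inv a @^-1` U)
    (fun x => to_chart a (chart_inv a x) (X (chart_inv a x))).

Definition vector_field (X : forall u : M, tangent u) :=
  vector_field_on [set: M] X.

(** Smoothness is that of the bundle map [TM -> TM], read in the charts of [TM]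
    induced by those of [M]. *)
Definition tensor_field (A : forall u : M, tangent u -> tangent u) :=
  (forall u, linear (A u)) /\
  forall a, smooth_on (chart_cod a `*` [set: model M])
    (fun xv : model M * model M =>
       let u := chart_inv a xv.1 in to_chart a u (A u (of_chart a u xv.2))).

End TangentVectors.

Arguments to_chart {R M} a u X.
Arguments of_chart {R M} a u v.
Arguments dfun {R M} f u X.

Section SmoothMaps.
Context {R : realType} {M N : manifold R}.

Definition smooth_map (f : M -> N) :=
  continuous f /\
  forall a b, smooth_on (chart_cod a `&` (f \o chart_inv a) @^-1` chart_dom b)
                        (chart b \o f \o chart_inv a).

(** [mdiff f u] is [f_*] at [u]. *)
Definition mdiff (f : M -> N) (u : M) (X : tangent u) : tangent (f u) :=
  gderive (chart (chart_at (f u)) \o f \o chart_inv (chart_at u))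
          (chart (chart_at u) u) X.

Arguments mdiff f u X : clear implicits.

Definition pullback (f : M -> N) (u : M) (alpha : tangent (f u) -> R)
    (X : tangent u) : R := alpha (mdiff f u X).

Arguments pullback f u alpha X : clear implicits.

(** Topological embedding and immersion.  In the infinite-dimensional case an
    immersion is required to have differentials that split, i.e. that admit a
    continuous linear left inverse. *)
Definition smooth_embedding (f : M -> N) :=
  [/\ smooth_map f,
      injective f,
      (forall O : set M, open O ->
         exists2 O' : set N, open O' & O = f @^-1` O') &
      (forall u : M, exists L : tangent (f u) -> tangent u,
         [/\ linear L, continuous L & forall X, L (mdiff f u X) = X])].

End SmoothMaps.

Arguments mdiff {R M N} f u X.
Arguments pullback {R M N} f u alpha X.

(** * Systems [du/dt + \sum_j A^j du/dx^j = Q|_u]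

    The space-time variables range over [R * 'rV[R]_d]. *)

Definition dir_t (R : realType) (d : nat) : R * 'rV[R]_d := (1, 0).

Definition dir_x (R : realType) (d : nat) (j : 'I_d) : R * 'rV[R]_d :=
  (0, delta_mx 0 j).

Section Systems.
Context {R : realType} {M : manifold R} {d : nat}.

(** [F] is the flux of [c].  The vector fields are smooth sections of [TM] over
    arbitrary open subsets: an infinite-dimensional manifold may have too few
    global ones, while on a finite-dimensional one every tangent vector extends
    to a global one, so that nothing changes. *)
Definition is_flux (A : 'I_d -> forall u : M, tangent u -> tangent u)
    (c : M -> R) (F : M -> 'rV[R]_d) :=
  [/\ smooth_function c,
      smooth_function F &
      forall (U : set M) (X : forall u : M, tangent u),
        open U -> vector_field_on U X ->
        forall (j : 'I_d) (u : M), U u ->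
          dfun (fun w => F w 0 j) u (X u) = dfun c u (A j u (X u))].

(** Derivative at [z], in the direction [e], of a map with values in [M]. *)
Definition mderivable (w : R * 'rV[R]_d -> M) (z e : R * 'rV[R]_d) :=
  gderivable (chart (chart_at (w z)) \o w) z e.

Definition mderive (w : R * 'rV[R]_d -> M) (z e : R * 'rV[R]_d) :
    tangent (w z) :=
  gderive (chart (chart_at (w z)) \o w) z e.

(** Classical solutions on an open set [O] of space-time. *)
Definition is_solution (A : 'I_d -> forall u : M, tangent u -> tangent u)
    (Q : forall u : M, tangent u) (O : set (R * 'rV[R]_d))
    (w : R * 'rV[R]_d -> M) :=
  forall z, O z ->
    [/\ {for z, continuous w},
        mderivable w z (dir_t R d),
        (forall j, mderivable w z (dir_x R j)) &
        mderive w z (dir_t R d) + \sum_(j < d) A j (w z) (mderive w z (dir_x R j))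
          = Q (w z)].

End Systems.

Section ReducedModel.
Context {R : realType} {M Mh : manifold R}.
Variables (i : Mh -> M) (p : M -> Mh).

(** Under [p \o i = id], [p_*] at [i u] takes values in
    [tangent (p (i u)) = tangent u]. *)
Definition reduced_tensor (A : forall u : M, tangent u -> tangent u)
    (u : Mh) (X : tangent u) : tangent u :=
  mdiff p (i u) (A (i u) (mdiff i u X)).

Definition reduced_field (Q : forall u : M, tangent u) (u : Mh) : tangent u :=
  mdiff p (i u) (Q (i u)).

End ReducedModel.

(* Main.v *)
(** The hypothesis says [<d(c o i), p_* Y> = <dc, Y>] for every vector [Y] at
    [i(u)].  With [Y = A^j i_* X] it gives
    [<d(c o i), p_* A^j i_* X> = <dc, A^j i_* X> = <dF^j, i_* X>
     = <d(F^j o i), X>],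
    the flux identity; with [Y = Q] along a solution it gives the right-hand
    side of the balance law.  The rest is the chain rule for smooth maps between
    locally convex spaces, whose only analytic input is a mean value theorem: if
    the difference quotients of a curve near each of its points lie in a convex
    set, so does its increment over [0, 1].  The pointwise form of the flux
    identity follows from the one on vector fields because every tangent vector
    extends to a field that is constant in a chart. *)

Require Import Defs.
From HB Require Import structures.
From mathcomp Require Import all_boot all_order all_algebra.
From mathcomp Require Import all_classical all_reals all_analysis.
From mathcomp Require Import ring lra.
Set Implicit Arguments.
Unset Strict Implicit.
Unset Printing Implicit Defensive.

Import Order.TTheory GRing.Theory Num.Theory.
Import numFieldNormedType.Exports.
Local Open Scope classical_set_scope.
Local Open Scope ring_scope.

(** * Convex sets in locally convex spaces and a mean value theorem *)

Definition convex_subset (R : realType) (E : lmodType R) (K : set E) :=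
  forall (t : R) x y, 0 <= t <= 1 -> K x -> K y -> K (t *: x + (1 - t) *: y).

Lemma convex_open_nbhs (R : realType) (E : tvsType R) (x : E) (A : set E) :
  nbhs x A -> exists K : set E, [/\ open K, K x, K `<=` A & convex_subset K].
Proof.
move=> xA.
have [B Bconv [Bopen /(_ x A xA)[K [BK Kx] KA]]] := @locally_convex R E.
exists K; split=> //; first exact: Bopen.
move=> t y z t01 Ky Kz.
have := Bconv K (mem_set BK) y z (Itv01 (andP t01).1 (andP t01).2).
by rewrite !inE; apply.
Qed.

(** The slope over [[a, c]] is the convex combination of the slopes over [[a, b]] and [[b, c]],
    weighted by the relative lengths of these intervals. *)
Lemma convex_subset_slope (R : realType) (E : lmodType R) (K : set E)
    (g : R -> E) (a b c : R) :
  convex_subset K -> a < b -> b < c ->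
  K ((b - a)^-1 *: (g b - g a)) -> K ((c - b)^-1 *: (g c - g b)) ->
  K ((c - a)^-1 *: (g c - g a)).
Proof.
move=> Kconv ab bc Kab Kbc.
have ba0 : b - a != 0 by rewrite gt_eqF// subr_gt0.
have cb0 : c - b != 0 by rewrite gt_eqF// subr_gt0.
have ca0 : c - a != 0 by rewrite gt_eqF// subr_gt0 (lt_trans ab).
have t01 : 0 <= (b - a) / (c - a) <= 1.
  by rewrite divr_ge0 ?ler_pdivrMr ?mul1r ?subr_gt0 ?subr_ge0; lra.
have -> : (c - a)^-1 *: (g c - g a) =
    ((b - a) / (c - a)) *: ((b - a)^-1 *: (g b - g a)) +
    (1 - (b - a) / (c - a)) *: ((c - b)^-1 *: (g c - g b)).
  rewrite !scalerA.
  have -> : (1 - (b - a) / (c - a)) / (c - b) = (c - a)^-1.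
    by field; rewrite ca0 cb0.
  rewrite mulrAC divff// mul1r -scalerDr; congr (_ *: _).
  by rewrite [RHS]addrC [RHS]addrA subrK.
exact: Kconv.
Qed.

(* The set of [s] such that the slope on [0, s] lies in [K] is shown to reach 1
   by a supremum argument; no norm and no Hahn-Banach theorem is needed. *)
Lemma mean_value_convex (R : realType) (E : tvsType R) (K : set E)
    (g : R -> E) :
  convex_subset K ->
  (forall s, 0 <= s <= 1 ->
    \forall t \near 0^', K (t^-1 *: (g (t + s) - g s))) ->
  K (g 1 - g 0).
Proof.
move=> Kconv gK.
have slope s : 0 <= s <= 1 -> exists2 e : R, 0 < e &
    forall r, `|r - s| < e -> r != s -> K ((r - s)^-1 *: (g r - g s)).
  move=> /gK /nbhs_ballP[e /= e0 eK]; exists e => // r rs rNs.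
  have := eK (r - s); rewrite /ball/= sub0r normrN subrK; apply=> //.
  by rewrite subr_eq0.
(* The case [s = 0] is separate: the degenerate slope there evaluates to [0], which need not lie in
   [K]. *)
pose P s := s = 0 \/ K ((s - 0)^-1 *: (g s - g 0)).
have Pcat s r : 0 <= s -> s < r -> P s -> K ((r - s)^-1 *: (g r - g s)) -> P r.
  move=> s0 sr [->|Ks] Kr; right=> //.
  have [s00|sN0] := eqVneq s 0; first by rewrite -s00.
  apply: (convex_subset_slope Kconv _ sr Ks Kr).
  by rewrite lt_neqAle eq_sym sN0.
pose S := [set s | 0 <= s <= 1 /\ P s].
have S0 : S 0 by split; [rewrite lexx ler01|left].
have Sub : has_ubound S by exists 1 => s [/andP[]].
have hS : has_sup S by split=> //; exists 0.
have t0 : 0 <= sup S by exact: ub_le_sup.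
have t1 : sup S <= 1 by apply: ge_sup; [exists 0|move=> s [/andP[]]].
have t01 : 0 <= sup S <= 1 by rewrite t0.
have [e e0 eK] := slope _ t01.
have Pt : P (sup S).
  (* The supremum is attained: some [s] in [S] lies within [e] to its left, and the slope between
     [s] and [sup S] is symmetric in its endpoints, so the estimate centred at [sup S] applies. *)
  have [s [/andP[s0 s1] Ps] ts] := sup_adherent e0 hS.
  have : s <= sup S by apply: ub_le_sup => //; split=> //; rewrite s0.
  rewrite le_eqVlt => /predU1P[<- //|st]; apply: (Pcat s) => //.
  rewrite -opprB -(opprB (g s)) invrN scaleNr scalerN opprK; apply: eK.
    by rewrite ltr0_norm ?subr_lt0//; lra.
  by rewrite lt_eqF.
have [t1E|tN1] := eqVneq (sup S) 1.
  move: Pt; rewrite t1E => -[/eqP|]; first by rewrite oner_eq0.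
  by rewrite subr0 invr1 scale1r.
have {tN1 t1} t1 : sup S < 1 by rewrite lt_neqAle tN1.
(* If [sup S < 1], this point to its right, still within [e] and at most 1, also belongs to [S]: a
   contradiction. *)
pose r := Num.min 1 (sup S + e / 2).
have tr : sup S < r by rewrite /r lt_min t1; lra.
have : r <= sup S.
  apply: ub_le_sup => //; split.
    by rewrite (le_trans t0 (ltW tr)) /r ge_min lexx.
  apply: (Pcat (sup S)) => //; apply: eK; last by rewrite gt_eqF.
  have : r <= sup S + e / 2 by rewrite /r ge_min lexx orbT.
  by rewrite gtr0_norm ?subr_gt0//; lra.
by rewrite leNgt tr.
Qed.

(** * Punctured limits at 0 and the calculus of directional derivatives *)

Lemma cvgD0 (R : realType) (E : tvsType R) (f g : R -> E) (a b : E) :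
  f @ 0^' --> a -> g @ 0^' --> b -> f t + g t @[t --> 0^'] --> a + b.
Proof.
move=> fa gb.
apply: (@continuous2_cvg _ _ _ _ _ _ _ _ (fun a b : E => a + b)) fa gb.
exact: (@add_continuous E (a, b)).
Qed.

Lemma cvgZ0 (R : realType) (E : tvsType R) (f : R -> R) (g : R -> E)
    (a : R) (b : E) :
  f @ 0^' --> a -> g @ 0^' --> b -> f t *: g t @[t --> 0^'] --> a *: b.
Proof.
move=> fa gb.
apply: (@continuous2_cvg _ _ _ _ _ _ _ _ (fun (a : R^o) (b : E) => a *: b))
  fa gb.
exact: (@scale_continuous R E (a, b)).
Qed.

Lemma near_eq_cvg0 (R : realType) (E : tvsType R) (f g : R -> E) (a : E) :
  (\forall h \near 0^', f h = g h) -> f @ 0^' --> a -> g @ 0^' --> a.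
Proof.
by move=> fg fa; apply: cvg_trans fa; exact: near_eq_cvg.
Qed.

Section DirectionalDerivatives.
Context {R : realType}.
Implicit Types E F G : tvsType R.

Lemma is_gderiveE E F (f : E -> F) x v l :
  hausdorff_space F -> is_gderive f x v l -> gderive f x v = l.
Proof.
move=> hF fl; rewrite /gderive; case: xgetP => [y _ fy|/(_ l)//].
exact: (cvg_unique hF fy fl).
Qed.

Lemma gderiveP E F (f : E -> F) x v :
  gderivable f x v -> is_gderive f x v (gderive f x v).
Proof. by move=> [l fl]; rewrite /gderive; case: xgetP => [y _ //|/(_ l)]. Qed.

Lemma line_cvg E (x v : E) : h *: v + x @[h --> (0 : R)^'] --> x.
Proof.
rewrite -[X in _ --> X](add0r x) -[X in X + x](scale0r v).
apply: cvgD0; last exact: cvg_cst.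
by apply: cvgZ0; [exact: nbhs_dnbhs|exact: cvg_cst].
Qed.

Lemma near_eq_is_gderive E F (f g : E -> F) x v l :
  (\forall y \near x, f y = g y) -> is_gderive f x v l -> is_gderive g x v l.
Proof.
move=> fg; apply: near_eq_cvg0; near=> h.
rewrite (nbhs_singleton fg); congr (_ *: (_ - _)).
by near: h; exact: (line_cvg v fg).
Unshelve. all: by end_near. Qed.

Lemma near_eq_gderivable E F (f g : E -> F) x v :
  (\forall y \near x, f y = g y) -> gderivable f x v -> gderivable g x v.
Proof. by move=> fg [l /(near_eq_is_gderive fg) gl]; exists l. Qed.

Lemma near_eq_gderive E F (f g : E -> F) x v :
  (\forall y \near x, f y = g y) -> gderive f x v = gderive g x v.
Proof.
move=> fg; rewrite /gderive; congr (xget 0 _); apply/seteqP; split=> l /=.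
  exact: near_eq_is_gderive.
by apply: near_eq_is_gderive; apply: filterS fg => y.
Qed.

(* Strict differentiability: all the difference quotients involved are
   slopes of [f] along small segments, which the mean value theorem controls
   by the values of the derivative near [(y, w)]. *)
Lemma increment_cvg E F (f : E -> F) (U : set E) (y w : E) (yy ww : R -> E) :
  nbhs y U -> (forall x v, U x -> gderivable f x v) ->
  {for (y, w), continuous (fun xv : E * E => gderive f xv.1 xv.2)} ->
  yy h @[h --> (0 : R)^'] --> y -> ww h @[h --> (0 : R)^'] --> w ->
  h^-1 *: (f (h *: ww h + yy h) - f (yy h)) @[h --> (0 : R)^']
    --> gderive f y w.
Proof.
move=> yU fU fc yyc wwc A /convex_open_nbhs[K [Kop Kyw KA Kconv]].
have [[N W] [/= Ny Ww] NWK] := fc _ (open_nbhs_nbhs (conj Kop Kyw)).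
(* Convexity of [N'] keeps the whole segment from [yy h] to [h *: ww h + yy h] inside both [N] and
   [U]. *)
have [N' [N'op N'y N'N N'conv]] := convex_open_nbhs (filterI Ny yU).
have hwc : h *: ww h + yy h @[h --> (0 : R)^'] --> y.
  rewrite -[X in _ --> X](add0r y) -[X in X + y](scale0r w).
  by apply: cvgD0 => //; apply: cvgZ0 => //; exact: nbhs_dnbhs.
have N'yy := yyc _ (open_nbhs_nbhs (conj N'op N'y)).
have N'hw := hwc _ (open_nbhs_nbhs (conj N'op N'y)).
suff : \forall h \near 0^', K (h^-1 *: (f (h *: ww h + yy h) - f (yy h))).
  by apply: filterS => h /KA.
near=> h.
have hN0 : h != 0 by near: h; exact: nbhs_dnbhs_neq.
have Wh : W (ww h) by near: h; exact: wwc.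
have N0 : N' (yy h) by near: h.
have N1 : N' (h *: ww h + yy h) by near: h.
(* The factor [h^-1] makes the increment of [g] over [[0, 1]] equal to the difference quotient under
   study. *)
pose g s := h^-1 *: f ((s * h) *: ww h + yy h).
have : K (g 1 - g 0); last by rewrite /g mul1r mul0r scale0r add0r -scalerBr.
apply: mean_value_convex => // s s01.
pose z := (s * h) *: ww h + yy h.
have /N'N[Nz Uz] : N' z.
  have := N'conv _ _ _ s01 N1 N0.
  by rewrite scalerDr scalerA scalerBl scale1r -addrA (addrC (s *: _)) subrK.
have Kz := open_nbhs_nbhs (conj Kop (NWK (z, ww h) (conj Nz Wh))).
(* A slope of [g] with step [t] is a difference quotient of [f] in direction [ww h] with step
   [t * h], so punctured limits in [t] must be compared with those in [t * h]. *)
have th0 : t * h @[t --> (0 : R)^'] --> (0 : R)^'.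
  move=> B /nbhs_ballP[e /= e0 eB].
  apply/nbhs_ballP; exists (e / `|h|); first by rewrite /= divr_gt0 ?normr_gt0.
  move=> t; rewrite /ball/= !sub0r !normrN ltr_pdivlMr ?normr_gt0// => te tN0.
  by apply: eB; rewrite /ball/= ?sub0r ?normrN ?normrM// mulf_neq0.
have Kq : \forall t \near (0 : R)^',
    K ((t * h)^-1 *: (f ((t * h) *: ww h + z) - f z)).
  exact: th0 _ (gderiveP (fU z (ww h) Uz) Kz).
apply: filterS Kq => t.
by rewrite /g invfM mulrDl scalerDl -addrA -scalerBr scalerA.
Unshelve. all: by end_near. Qed.

(** Chain rule: [increment_cvg] is applied with fixed base point [g x] and, as moving direction, the
    difference quotients of [g], since [h] times such a quotient plus [g x] is [g (h *: v + x)]. *)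
Lemma is_gderive_comp E F G (f : F -> G) (g : E -> F) (U : set F) (x v : E) w :
  nbhs (g x) U -> (forall y v, U y -> gderivable f y v) ->
  {for (g x, w), continuous (fun xv : F * F => gderive f xv.1 xv.2)} ->
  is_gderive g x v w -> is_gderive (f \o g) x v (gderive f (g x) w).
Proof.
move=> gxU fU fc gw.
refine (near_eq_cvg0 _ (increment_cvg gxU fU fc (cvg_cst (g x)) gw)).
near=> h.
have hN0 : h != 0 by near: h; exact: nbhs_dnbhs_neq.
by rewrite /= scalerA divff// scale1r subrK.
Unshelve. all: by end_near. Qed.

(** The increment along [v + w] is split at [h *: v + x]. The second piece has a moving base point,
    which is where strict differentiability enters. *)
Lemma gderiveD E F (f : E -> F) (U : set E) (x v w : E) :
  hausdorff_space F -> nbhs x U -> (forall y v, U y -> gderivable f y v) ->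
  {for (x, w), continuous (fun xv : E * E => gderive f xv.1 xv.2)} ->
  gderive f x (v + w) = gderive f x v + gderive f x w.
Proof.
move=> hF xU fU fc; apply: is_gderiveE => //.
have fv := gderiveP (fU x v (nbhs_singleton xU)).
refine (near_eq_cvg0 _ (cvgD0 fv
  (increment_cvg xU fU fc (@line_cvg _ x v) (cvg_cst w)))).
near=> h.
rewrite -scalerDr; congr (_ *: _).
by rewrite addrC subrKA addrA -scalerDr (addrC w).
Unshelve. all: by end_near. Qed.

Lemma is_gderive_linear E F (L : E -> F) x v :
  linear L -> is_gderive L x v (L v).
Proof.
move=> linL; apply: cvg_near_cst; near=> h.
have hN0 : h != 0 by near: h; exact: nbhs_dnbhs_neq.
by rewrite linL addrK scalerA mulVf// scale1r.
Unshelve. all: by end_near. Qed.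

Lemma is_gderive_cst E F (c : F) (x v : E) : is_gderive (fun=> c) x v 0.
Proof.
apply: cvg_near_cst; apply: nearW => h.
by rewrite subrr scaler0.
Qed.

Lemma is_gderive_pair E F G (f : E -> F) (g : E -> G) x v k l :
  is_gderive f x v k -> is_gderive g x v l ->
  is_gderive (fun y => (f y, g y)) x v (k, l).
Proof. by move=> fk gl; exact: (cvg_pair fk gl). Qed.

Lemma hausdorff_prod (S T : topologicalType) :
  hausdorff_space S -> hausdorff_space T -> hausdorff_space (S * T)%type.
Proof.
move=> hS hT [a b] [a' b'] ab.
suff [-> ->] : a = a' /\ b = b' by [].
split; [apply: hS|apply: hT] => A B aA bB.
  have [||[p q] [[pA _] [pB _]]] := ab (A `*` setT) (B `*` setT).
  - by exists (A, setT) => //; split=> //; exact: filterT.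
  - by exists (B, setT) => //; split=> //; exact: filterT.
  by exists p.
have [||[p q] [[_ qA] [_ qB]]] := ab (setT `*` A) (setT `*` B).
- by exists (setT, A) => //; split=> //; exact: filterT.
- by exists (setT, B) => //; split=> //; exact: filterT.
by exists q.
Qed.

End DirectionalDerivatives.

(** * Stability properties of C^n maps in the sense of Michal and Bastiani *)

Section MichalBastiani.
Context {R : realType}.
Implicit Types E F G : tvsType R.

Lemma open_setXT (S T : topologicalType) (U : set S) :
  open U -> open (U `*` [set: T]).
Proof.
rewrite openE => Uo; rewrite openE => -[x y] [/= /Uo Ux _].
by exists (U, setT) => //; split=> //; exact: filterT.
Qed.

Lemma near_eq_continuous (S T : topologicalType) (f g : S -> T) x :
  (\forall y \near x, f y = g y) ->
  {for x, continuous f} -> {for x, continuous g}.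
Proof.
move=> fg fc A; rewrite -(nbhs_singleton fg) => /fc fA.
have {}fA : \forall y \near x, A (f y) by exact: fA.
by apply: filterS2 fg fA => y /= <-.
Qed.

Lemma Cn_continuous n E F (U : set E) (f : E -> F) x :
  Cn n U f -> U x -> {for x, continuous f}.
Proof. by case: n => [|n] [fc _]; exact: fc. Qed.

Lemma Cn_pred n E F (U : set E) (f : E -> F) : Cn n.+1 U f -> Cn n U f.
Proof.
elim: n E F U f => [|n IH] E F U f [fc [fd Cdf]]; first by split.
by split=> //; split=> //; exact: IH.
Qed.

(** Derivatives at a point depend on the values nearby; as [U] is open, agreement on [U] is
    agreement near each of its points. *)
Lemma eq_Cn n E F (U : set E) (f g : E -> F) :
  open U -> (forall x, U x -> f x = g x) -> Cn n U f -> Cn n U g.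
Proof.
elim: n E F U f g => [|n IH] E F U f g Uo fg [fc fd];
  have fgn x : U x -> \forall y \near x, f y = g y by
    move=> Ux; apply: filterS (open_nbhs_nbhs (conj Uo Ux)).
  by split=> // x Ux; exact: near_eq_continuous (fgn x Ux) (fc x Ux).
split=> [x Ux|]; first exact: near_eq_continuous (fgn x Ux) (fc x Ux).
case: fd => fd Cdf; split=> [x v Ux|].
  exact: near_eq_gderivable (fgn x Ux) (fd x v Ux).
apply: IH Cdf; first exact: open_setXT.
by move=> [x v] [/= Ux _]; exact: near_eq_gderive (fgn x Ux).
Qed.

(** Each clause of [Cn] is a condition at single points of the set. This allows the chart of the
    target to change from point to point. *)
Lemma Cn_local n E F (U : set E) (f : E -> F) :
  (forall x, U x -> exists2 V, V x & Cn n V f) -> Cn n U f.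
Proof.
elim: n E F U f => [|n IH] E F U f fU.
  by split=> // x /fU[V Vx [fc _]]; exact: fc.
split=> [x /fU[V Vx [fc _]]|]; first exact: fc.
split=> [x v /fU[V Vx [_ [fd _]]]|]; first exact: fd.
apply: IH => -[x v] [/= /fU[V Vx [_ [_ Cdf]]] _].
by exists (V `*` setT).
Qed.

(** The derivative of [L] is [L \o snd], again linear and continuous, so the induction closes. *)
Lemma Cn_linear n E F (U : set E) (L : E -> F) :
  hausdorff_space F -> linear L -> continuous L -> Cn n U L.
Proof.
move=> hF; elim: n E U L => [|n IH] E U L linL Lc.
  by split=> // x _; exact: Lc.
split=> [x _|]; first exact: Lc.
split=> [x v _|]; first by exists (L v); exact: is_gderive_linear.
have -> : (fun xv : E * E => gderive L xv.1 xv.2) = L \o snd.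
  apply/funext => -[x v] /=.
  by apply: is_gderiveE => //; exact: is_gderive_linear.
apply: IH => [a u v /=|x]; first exact: linL.
by apply: continuous_comp; [exact: cvg_snd|exact: Lc].
Qed.

Lemma Cn_cst n E F (U : set E) (c : F) : hausdorff_space F -> Cn n U (fun=> c).
Proof.
move=> hF; elim: n E U c => [|n IH] E U c.
  by split=> // x _; exact: cst_continuous.
split=> [x _|]; first exact: cst_continuous.
split=> [x v _|]; first by exists 0; exact: is_gderive_cst.
have -> : (fun xv : E * E => gderive (fun=> c) xv.1 xv.2) = (fun=> 0 : F).
  by apply/funext => xv; apply: is_gderiveE => //; exact: is_gderive_cst.
exact: IH.
Qed.

Lemma Cn_pair n E F G (U : set E) (f : E -> F) (g : E -> G) :
  hausdorff_space F -> hausdorff_space G -> open U ->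
  Cn n U f -> Cn n U g -> Cn n U (fun x => (f x, g x)).
Proof.
move=> hF hG; have hFG := hausdorff_prod hF hG.
elim: n E U f g => [|n IH] E U f g Uo [fc fd] [gc gd].
  by split=> // x Ux; apply: cvg_pair; [exact: fc|exact: gc].
split=> [x Ux|]; first by apply: cvg_pair; [exact: fc|exact: gc].
case: fd => fd Cdf; case: gd => gd Cdg.
have fgd x v : U x -> is_gderive (fun y => (f y, g y)) x v
    (gderive f x v, gderive g x v).
  move=> Ux; apply: is_gderive_pair; apply: gderiveP; [exact: fd|exact: gd].
split=> [x v Ux|]; first by eexists; exact: fgd.
apply: eq_Cn (IH _ _ _ _ (open_setXT Uo) Cdf Cdg); first exact: open_setXT.
by move=> [x v] [/= Ux _]; rewrite (is_gderiveE hFG (fgd x v Ux)).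
Qed.

Lemma is_gderive_comp_Cn1 E F G (V : set F) (f : F -> G) (g : E -> F) x v :
  open V -> Cn 1 V f -> V (g x) -> gderivable g x v ->
  is_gderive (f \o g) x v (gderive f (g x) (gderive g x v)).
Proof.
move=> Vo [_ [fd [fc _]]] Vgx gd; apply: (is_gderive_comp (U := V)) => //.
- exact: open_nbhs_nbhs.
- exact: fc.
- exact: gderiveP.
Qed.

Lemma Cn_leq m n E F (U : set E) (f : E -> F) :
  (m <= n)%N -> Cn n U f -> Cn m U f.
Proof.
elim: n => [|n IH]; first by rewrite leqn0 => /eqP ->.
by rewrite leq_eqVlt => /predU1P[-> //|] /IH mn /Cn_pred.
Qed.

(** The derivative of [f \o g] is the derivative of [f] composed with
    [(x, v) |-> (g x, gderive g x v)]. Both factors are C^n, so the induction hypothesis applies on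
    the product spaces. *)
Lemma Cn_comp n E F G (U : set E) (V : set F) (f : F -> G) (g : E -> F) :
  hausdorff_space E -> hausdorff_space F -> hausdorff_space G ->
  open U -> open V -> (forall x, U x -> V (g x)) ->
  Cn n V f -> Cn n U g -> Cn n U (f \o g).
Proof.
elim: n E F G U V f g => [|n IH] E F G U V f g hE hF hG Uo Vo gUV Cf Cg;
  have fgc x : U x -> {for x, continuous (f \o g)} by
    move=> Ux; apply: continuous_comp;
      [exact: Cn_continuous Cg Ux|exact: Cn_continuous Cf (gUV x Ux)].
  by split.
have fgd x v : U x -> is_gderive (f \o g) x v (gderive f (g x) (gderive g x v)).
  move=> Ux; apply: (is_gderive_comp_Cn1 Vo) => //;
    last by case: Cg => _ [+ _]; exact.
    exact: Cn_leq Cf.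
  exact: gUV.
split=> //; split=> [x v Ux|]; first by eexists; exact: fgd.
have UoT := open_setXT (T := E) Uo.
apply: (eq_Cn (f := (fun yw : F * F => gderive f yw.1 yw.2) \o
    (fun xv : E * E => (g xv.1, gderive g xv.1 xv.2)))) => //.
  by move=> [x v] [/= Ux _]; rewrite (is_gderiveE hG (fgd x v Ux)).
case: Cf => _ [_ Cdf]; have Cdg := Cg.2.2.
apply: (IH _ _ _ _ (V `*` setT)) => //; try exact: hausdorff_prod.
- exact: open_setXT.
- by move=> [x v] [/= /gUV].
- apply: Cn_pair => //.
  (* The component [g xv.1] is [g \o fst], which is C^n by a second use of the induction
     hypothesis. *)
  have Cfst : Cn n (U `*` [set: E]) (@fst E E).
    by apply: Cn_linear => // x; exact: cvg_fst.
  apply: (IH _ _ _ _ U g fst) => //; first exact: hausdorff_prod.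
    by move=> [x v] [].
  exact: Cn_pred.
Qed.

End MichalBastiani.

(** * Differentials and vector fields on manifolds, read in charts *)

Section ChartCalculus.
Context {R : realType}.
Implicit Types M N : manifold R.

Lemma open_setI_preimage (S T : topologicalType) (A : set S) (B : set T)
    (f : S -> T) :
  open A -> (forall x, A x -> {for x, continuous f}) -> open B ->
  open (A `&` f @^-1` B).
Proof.
move=> Ao fc Bo; rewrite openE => x [Ax Bfx].
by apply: filterI; [exact: open_nbhs_nbhs|exact: fc (open_nbhs_nbhs _)].
Qed.

Lemma open_chart_overlap M (a b : chart_index M) :
  open (chart_cod a `&` chart_inv a @^-1` chart_dom b).
Proof.
apply: open_setI_preimage; [exact: chart_cod_open| |exact: chart_dom_open].
by move=> x; exact: chart_inv_continuous.
Qed.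

(** Near [z] the map factors as [(f \o chart_inv b) \o (chart b \o w)], and the chain rule between
    the model spaces applies. *)
Lemma is_gderive_through_chart M (E W : tvsType R) (f : M -> W) (w : E -> M)
    (b : chart_index M) (V : set (model M)) z e :
  open V -> Cn 1 V (f \o chart_inv b) -> V (chart b (w z)) ->
  chart_dom b (w z) -> {for z, continuous w} -> gderivable (chart b \o w) z e ->
  is_gderive (f \o w) z e
    (gderive (f \o chart_inv b) (chart b (w z)) (gderive (chart b \o w) z e)).
Proof.
move=> Vo Cf Vz bz wc wd.
apply: near_eq_is_gderive (is_gderive_comp_Cn1 Vo Cf Vz wd).
have : \forall y \near z, chart_dom b (w y).
  exact: wc (open_nbhs_nbhs (conj (@chart_dom_open _ _ b) bz)).
by apply: filterS => y by_ /=; rewrite chartK.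
Qed.

(** Serves twice: with [E] the space-time for solutions, and with [E] a model space for maps between
    manifolds. *)
Lemma dfun_is_gderive M (E : tvsType R) (f : M -> R) (w : E -> M) z e :
  smooth_function f -> {for z, continuous w} ->
  gderivable (chart (chart_at (w z)) \o w) z e ->
  is_gderive (f \o w) z e
    (dfun f (w z) (gderive (chart (chart_at (w z)) \o w) z e)).
Proof.
move=> fs wc wd; have bz := chart_atP (w z).
apply: (is_gderive_through_chart (V := chart_cod (chart_at (w z)))) => //.
- exact: chart_cod_open.
- exact: fs.
- exact: chart_domP.
Qed.

Lemma dfunD M (f : M -> R) (u : M) (X Y : tangent u) :
  smooth_function f -> dfun f u (X + Y) = dfun f u X + dfun f u Y.
Proof.
move=> /(_ (chart_at u) 1%N)[_ [fd [fc _]]].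
have ux := chart_domP (chart_atP u).
apply: gderiveD fd _; first exact: norm_hausdorff.
  exact: open_nbhs_nbhs (conj (@chart_cod_open _ _ _) ux).
exact: fc.
Qed.

Lemma dfun_sum M (f : M -> R) (u : M) (n : nat) (X : 'I_n -> tangent u) :
  smooth_function f ->
  dfun f u (\sum_(k < n) X k) = \sum_(k < n) dfun f u (X k).
Proof.
move=> fs; apply: (big_morph (dfun f u)) => [Y Z|]; first exact: dfunD.
(* Additivity alone gives the value [0] at the zero vector, by cancellation. *)
by apply: (addrI (dfun f u 0)); rewrite -dfunD// !addr0.
Qed.

Lemma smooth_function_comp M N (W : tvsType R) (f : N -> W) (i : M -> N) :
  hausdorff_space W -> smooth_map i -> smooth_function f ->
  smooth_function (f \o i).
Proof.
move=> hW [ic is_] fs a n; apply: Cn_local => x ax.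
(* Around each point, the argument is restricted to where [i] lands in a single chart [b]; there the
   map is a composite of smooth maps between model spaces. *)
pose b := chart_at (i (chart_inv a x)).
exists (chart_cod a `&` (i \o chart_inv a) @^-1` chart_dom b).
  by split=> //; exact: chart_atP.
have Vo : open (chart_cod a `&` (i \o chart_inv a) @^-1` chart_dom b).
  apply: open_setI_preimage; [exact: chart_cod_open| |exact: chart_dom_open].
  move=> y ay; apply: continuous_comp; last exact: ic.
  exact: chart_inv_continuous.
apply: (eq_Cn (f := (f \o chart_inv b) \o (chart b \o i \o chart_inv a))) => //.
  by move=> y [_ /= ybi]; rewrite chartK.
apply: (Cn_comp (V := chart_cod b)) => //; try exact: model_hausdorff.
- exact: chart_cod_open.
- by move=> y [_ yb]; exact: chart_domP.
- exact: fs.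
- exact: is_.
Qed.

(** [dfun_is_gderive] is applied to [i] read in the selected chart at [u]; its derivative along [X]
    is [mdiff i u X] by definition. *)
Lemma dfun_comp M N (f : N -> R) (i : M -> N) (u : M) (X : tangent u) :
  smooth_map i -> smooth_function f ->
  dfun (f \o i) u X = dfun f (i u) (mdiff i u X).
Proof.
move=> [ic is_] fs; have ua := chart_atP u.
pose a := chart_at u; have wu : (i \o chart_inv a) (chart a u) = i u.
  by rewrite /= chartK.
apply: is_gderiveE; first exact: norm_hausdorff.
have := @dfun_is_gderive N (model M) f (i \o chart_inv a) (chart a u) X fs.
rewrite wu; apply.
- apply: continuous_comp; last exact: ic.
  exact: chart_inv_continuous (chart_domP ua).
- have [_ [+ _]] := is_ a (chart_at (i u)) 1%N; apply.
  by split; [exact: chart_domP|rewrite /= chartK//; exact: chart_atP].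
Qed.

Lemma of_chart_at M (u : M) (Y : tangent u) : of_chart (chart_at u) u Y = Y.
Proof.
have ua := chart_atP u; rewrite /of_chart.
rewrite (near_eq_gderive (g := id)).
  by apply: is_gderiveE; [exact: model_hausdorff|exact: is_gderive_linear].
have := open_nbhs_nbhs (conj (@chart_cod_open _ _ _) (chart_domP ua)).
by apply: filterS => x /= ax; rewrite chart_invK.
Qed.

(** The transition from [a] to [b] is factored through the selected chart at [u], so that chart
    drops out. This matters because [chart_at] may vary with no regularity. *)
Lemma to_chart_of_chart M (a b : chart_index M) (u : M) (Y : model M) :
  chart_dom a u -> chart_dom b u ->
  to_chart b u (of_chart a u Y) = gderive (chart b \o chart_inv a) (chart a u) Y.
Proof.
move=> ua ub; have uc := chart_atP u; apply/esym/is_gderiveE.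
  exact: model_hausdorff.
have := @is_gderive_through_chart M (model M) (model M) (chart b) (chart_inv a)
  (chart_at u) _ (chart a u) Y (open_chart_overlap (chart_at u) b)
  (@chart_transition _ _ (chart_at u) b 1%N).
rewrite chartK//; apply=> //.
- by split; [exact: chart_domP|rewrite /= chartK].
- exact: chart_inv_continuous (chart_domP ua).
- have [_ [+ _]] := @chart_transition _ _ a (chart_at u) 1%N; apply.
  by split; [exact: chart_domP|rewrite /= chartK].
Qed.

(** The field is constantly [Y] in the chart [a]. In a chart [b] it is the derivative of the
    transition from [a] to [b] along [Y], at the [a]-coordinates of the point. *)
Lemma vector_field_on_of_chart M (a : chart_index M) (Y : model M) :
  vector_field_on (chart_dom a) (fun u : M => of_chart a u Y).
Proof.
move=> b n; have hM := @model_hausdorff _ M.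
pose D (xv : model M * model M) := gderive (chart b \o chart_inv a) xv.1 xv.2.
apply: (eq_Cn (f := D \o (fun x => ((chart a \o chart_inv b) x, Y)))).
- exact: open_chart_overlap.
- move=> x [bx ax]; rewrite to_chart_of_chart//; exact: chart_codP.
(* One order is spent on the derivative, hence [n.+1]. *)
have [_ [_ CD]] := @chart_transition _ _ a b n.+1.
apply: (Cn_comp _ _ hM _ (open_setXT (open_chart_overlap a b)) _ CD) => //.
- exact: hausdorff_prod.
- exact: open_chart_overlap.
- move=> x [bx ax]; split=> //=; split; first exact: chart_domP.
  by rewrite /= chartK//; exact: chart_codP.
- apply: Cn_pair => //; first exact: open_chart_overlap.
    exact: chart_transition.
  exact: Cn_cst.
Qed.

Lemma is_flux_dfun M d (A : 'I_d -> forall u : M, tangent u -> tangent u)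
    (c : M -> R) (F : M -> 'rV[R]_d) (j : 'I_d) (u : M) (Y : tangent u) :
  is_flux A c F -> dfun (fun v => F v 0 j) u Y = dfun c u (A j u Y).
Proof.
move=> [_ _ /(_ _ _ (@chart_dom_open _ _ (chart_at u))
  (vector_field_on_of_chart (chart_at u) Y) j u (chart_atP u))].
by rewrite of_chart_at.
Qed.

Lemma smooth_function_coord M d (F : M -> 'rV[R]_d) (j : 'I_d) :
  smooth_function F -> smooth_function (fun v => F v 0 j).
Proof.
move=> Fs a n.
apply: (@Cn_comp _ n _ 'rV[R]_d _ _ setT (fun v : 'rV[R]_d => v 0 j)) => //.
- exact: model_hausdorff.
- exact: chart_cod_open.
- exact: openT.
- apply: Cn_linear; first exact: norm_hausdorff.
    by move=> k v w; rewrite !mxE.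
  exact: coord_continuous.
- exact: Fs.
Qed.

(** On normed modules [is_gderive] unfolds to convergence of the library's own difference
    quotients. *)
Lemma is_gderive_derive (V W : normedModType R) (f : V -> W) (z e : V) l :
  is_gderive f z e l -> derivable f z e /\ 'D_e f z = l.
Proof.
move=> fl; split; first by apply/cvg_ex; exists l.
by apply: cvg_lim; [exact: norm_hausdorff|exact: fl].
Qed.

End ChartCalculus.

(** * The flux of the reduced model and its balance law *)

Theorem theorem3 (R : realType) (d : nat) (M Mh : manifold R)
  (A : 'I_d -> forall u : M, tangent u -> tangent u)
  (Q : forall u : M, tangent u)
  (hA : forall j, tensor_field (A j)) (hQ : vector_field Q)
  (i : Mh -> M) (p : M -> Mh)
  (hi : smooth_embedding i) (hp : smooth_map p) (hpi : p \o i = id)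
  (c : M -> R) (F : M -> 'rV[R]_d) (hF : is_flux A c F)
  (hc : forall uh : Mh, pullback p (i uh) (dfun (c \o i) uh) = dfun c (i uh)) :
  is_flux (fun j => reduced_tensor i p (A j)) (c \o i) (F \o i) /\
  forall (O : set (R * 'rV[R]_d)) (uh : R * 'rV[R]_d -> Mh),
    open O ->
    is_solution (fun j => reduced_tensor i p (A j)) (reduced_field i p Q) O uh ->
    forall z, O z ->
      [/\ derivable ((c \o i) \o uh) z (dir_t R d),
          (forall j, derivable (fun z' => (F \o i) (uh z') 0 j) z (dir_x R j)) &
          'D_(dir_t R d) ((c \o i) \o uh) z
            + \sum_(j < d) 'D_(dir_x R j) (fun z' => (F \o i) (uh z') 0 j) z
          = dfun c (i (uh z)) (Q (i (uh z)))].
Proof.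
have [is_ _ _ _] := hi; have [cs Fs _] := hF.
(* The covector hypothesis evaluated on vectors; [mdiff p (i u) X] is accepted as a vector at [u]
   because the carriers of tangent spaces coincide. *)
have hcE u (X : tangent (i u)) :
    dfun (c \o i) u (mdiff p (i u) X) = dfun c (i u) X.
  by rewrite -hc.
have cis : smooth_function (c \o i).
  by apply: smooth_function_comp => //; exact: norm_hausdorff.
have Fis : smooth_function (F \o i).
  by apply: smooth_function_comp => //; exact: norm_hausdorff.
have flux : is_flux (fun j => reduced_tensor i p (A j)) (c \o i) (F \o i).
  split=> // U X _ _ j u _.
  rewrite (dfun_comp (f := fun v => F v 0 j))//;
    last exact: smooth_function_coord.
  by rewrite (is_flux_dfun _ _ hF) /reduced_tensor hcE.
split=> // O uh _ sol z /sol[uhc dt dx eq].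
have dc := is_gderive_derive (dfun_is_gderive cis uhc dt).
have dF j := is_gderive_derive
  (dfun_is_gderive (smooth_function_coord j Fis) uhc (dx j)).
split; [exact: dc.1|by move=> j; exact: (dF j).1|].
(* The source term becomes the differential of [c \o i] on the reduced field, which the equation
   replaces by its left-hand side; the sum over [j] then matches term by term through the reduced
   flux identity. *)
rewrite dc.2 (eq_bigr _ (fun j _ => (dF j).2)) -hcE.
rewrite -/(reduced_field i p Q (uh z)) -eq dfunD// dfun_sum//; congr (_ + _).
by apply: eq_bigr => j _; exact: is_flux_dfun flux.
Qed.
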